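(* Let $\eta\in[0,1]$ and let $\mathcal{C}$ be a concept class of functions $X\to\{\pm1\}$ with VC dimension $d\ge 4$. There exists a probability distribution over pairs $(\boldsymbol{\mathcal{D}}_{\mathbf{c}}, \boldsymbol{\mathcal{D}}^{(\mathrm{corr})})$ such that, with probability $1$, $\boldsymbol{\mathcal{D}}_{\mathbf{c}}$ is the distribution of $(\mathbf{x},\mathbf{c}(\mathbf{x}))_{\mathbf{x}\sim\boldsymbol{\mathcal{D}}}$ for some $\mathbf{c}\in\mathcal{C}$ and some distribution $\boldsymbol{\mathcal{D}}$ over $X$, and $\boldsymbol{\mathcal{D}}^{(\mathrm{corr})}$ is a distribution over $X\times\{\pm1\}$ with $d_{\mathrm{TV}}(\boldsymbol{\mathcal{D}}_{\mathbf{c}}, \boldsymbol{\mathcal{D}}^{(\mathrm{corr})}) \le \eta$; and such that for every (possibly randomized) algorithm $A$ mapping a distribution over labeled examples to a (possibly randomized) hypothesis, \[ \mathbb{E}_{\mathbf{h}\leftarrow A(\boldsymbol{\mathcal{D}}^{(\mathrm{corr})})}\left[\Pr_{(\mathbf{x},\mathbf{y})\sim \boldsymbol{\mathcal{D}}_{\mathbf{c}}}[\mathbf{h}(\mathbf{x})\ne\mathbf{y}]\right] \ge \min\left\{\tfrac12, \tfrac{3\eta}{2}\right\} - O\!\left(\tfrac1d\right), \] where the expectation is also over the random pair.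
   Context: $d_{\mathrm{TV}}$ denotes total variation distance. This corresponds to $\eta$-TV noise: given base distribution $\mathcal{D}$ and concept $c$, with $\mathcal{D}_c$ the distribution of $(\mathbf{x},c(\mathbf{x}))$, $\mathbf{x}\sim\mathcal{D}$, the adversary chooses any distribution $\mathcal{D}^{(\mathrm{corr})}$ over labeled examples with $d_{\mathrm{TV}}(\mathcal{D}_c,\mathcal{D}^{(\mathrm{corr})})\le\eta$ and the learner receives samples from $\mathcal{D}^{(\mathrm{corr})}$ (here, the whole distribution). The $O(1/d)$ hides an absolute constant. *)

(* Defs.v *)
From HB Require Import structures.
From mathcomp Require Export all_boot all_order all_algebra.
From mathcomp Require Export all_classical all_reals all_analysis.

Set Implicit Arguments.
Unset Strict Implicit.
Unset Printing Implicit Defensive.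

Export Order.TTheory GRing.Theory Num.Theory.

Local Open Scope classical_set_scope.
Local Open Scope card_scope.
Local Open Scope ring_scope.
Local Open Scope ereal_scope.

(* Labels {+1, -1} are encoded by bool (true for +1, false for -1), with its
   discrete sigma-algebra. *)

Definition shatters (X : Type) (C : set (X -> bool)) (S : set X) : Prop :=
  forall B : set X, B `<=` S ->
    exists2 c, C c & S `&` [set x | c x = true] = B.

Definition has_VCdim (X : Type) (C : set (X -> bool)) (d : nat) : Prop :=
  (exists2 S : set X, S #= `I_d & shatters C S) /\
  (forall (n : nat) (S : set X), S #= `I_n -> shatters C S -> (n <= d)%N).

Definition dTV (R : realType) (dd : measure_display) (T : measurableType dd)
    (mu nu : probability T R) : \bar R :=
  ereal_sup [set `|mu E - nu E| | E in measurable].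

(* [mu] is the law of (x, c x) for x drawn from [D]; two measures are compared
   on measurable sets only, since a measure is a function on all sets. *)
Definition is_labeled_law (R : realType) (dd : measure_display)
    (X : measurableType dd) (D : probability X R) (c : X -> bool)
    (mu : probability (X * bool)%type R) : Prop :=
  forall E, measurable E -> mu E = pushforward D (fun x => (x, c x)) E.

(* A random hypothesis [h]: a seed [w] is drawn from [rh_law], and selects the
   hypothesis [x |-> rh_pred (w, x)].  The selected hypothesis may itself be
   randomized, hence a probability kernel to bool rather than a function. *)
Record rand_hyp (R : realType) (dd : measure_display)
    (X : measurableType dd) := RandHyp {
  rh_disp : measure_display ;
  rh_seed : measurableType rh_disp ;
  rh_law : probability rh_seed R ;
  rh_pred : R.-pker (rh_seed * X)%type ~> bool }.

(* An arbitrary map: no measurability in the input distribution is imposed. *)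
Definition algorithm (R : realType) (dd : measure_display)
    (X : measurableType dd) :=
  probability (X * bool)%type R -> rand_hyp R X.

(* E_h [ Pr_{(x, y) ~ mu} [ h(x) <> y ] ] *)
Definition expected_error (R : realType) (dd : measure_display)
    (X : measurableType dd) (mu : probability (X * bool)%type R)
    (h : rand_hyp R X) : \bar R :=
  \int[rh_law h]_w \int[mu]_z rh_pred h (w, z.1) [set b | b != z.2].

(* Main.v *)
(* Take shattered points x_0, ..., x_(N+1) with N = d - 2, put
   m = min(1/3, eta), and split m = e + f with e = N f.  The corrupted
   distribution never depends on the random pair: it puts mass e on each of
   (x_0, true) and (x_0, false), mass f on each (x_(i+2), true), i < N, and the
   rest 1 - 3e on (x_1, true).  The clean distribution is determined by a
   uniform bit and a uniform index j < N: the bit labels x_0, which has mass e;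
   and x_(j+2) gets the extra mass e together with the label false.
   Its distance to the corrupted distribution is at most e + f = m.
   The hypothesis errs with probability 1/2 at x_0, losing e/2; with S the sum
   over i of its probabilities to predict false at x_(i+2), it loses on average
   at least e (1 - S/N) at x_(j+2) and f (S - S/N) at the other x_(i+2), that
   is at least e - f in total.  Hence the error is at least
   3e/2 - f = 3m/2 - O(1/d). *)
From HB Require Import structures.
From mathcomp Require Import measurable_realfun ring lra.
Require Import Defs.

Set Implicit Arguments.
Unset Strict Implicit.
Unset Printing Implicit Defensive.

Local Open Scope classical_set_scope.
Local Open Scope ring_scope.
Local Open Scope ereal_scope.

(** * Finitely supported probability measures, given by lists of weighted atoms *)

Section mixture.
Context (R : realType) (d : measure_display) (T : measurableType d).
Implicit Type s : seq ({nonneg R} * T).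

Let atom0 : {nonneg R} * T := (NngNum (lexx 0%R), point).

(** The proof [s1] is an argument so that the probability instance can be inferred from the term. *)
Definition mixture s (s1 : (\sum_(q <- s) q.1%:num = 1)%R) : set T -> \bar R :=
  msum (fun k => mscale (nth atom0 s k).1
                        (dirac (nth atom0 s k).2)) (size s).

Variables (s : seq ({nonneg R} * T)) (s1 : (\sum_(q <- s) q.1%:num = 1)%R).

HB.instance Definition _ := Measure.on (mixture s1).

Lemma mixtureE E :
  mixture s1 E = (\sum_(q <- s) q.1%:num * (q.2 \in E)%:R)%R%:E.
Proof.
rewrite (big_nth atom0) big_mkord -sumEFin /mixture /msum.
by apply: eq_bigr => k _; rewrite EFinM -diracE.
Qed.

Lemma mixture_setT : mixture s1 [set: T] = 1.
Proof.
rewrite mixtureE; congr EFin; rewrite -[RHS]s1; apply: eq_bigr => q _.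
by rewrite in_setT mulr1.
Qed.

HB.instance Definition _ :=
  Measure_isProbability.Build _ _ _ (mixture s1) mixture_setT.

Lemma ge0_integral_mixture (f : T -> \bar R) :
  (forall x, 0 <= f x) -> measurable_fun [set: T] f ->
  \int[mixture s1]_x f x = \sum_(q <- s) q.1%:num%:E * f q.2.
Proof.
move=> f0 mf; rewrite ge0_integral_measure_sum//.
rewrite (big_nth atom0) big_mkord; apply: eq_bigr => k _.
by rewrite ge0_integral_mscale//= integral_dirac//= diracT mul1e.
Qed.

End mixture.

(** * Error of a random hypothesis against a finite mixture *)

Section expected_error.
Context (R : realType) (d : measure_display) (X : measurableType d).
Variable h : rand_hyp R X.
Local Notation k := (rh_pred h).

Lemma measurable_rh_error w :
  measurable_fun [set: X * bool] (fun z => k (w, z.1) [set b | b != z.2]).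
Proof.
have m B : measurable_fun [set: X] (fun x => k (w, x) B).
  exact: (measurable_fun_pair2 (f := fun z => k z B) w (measurable_kernel k B _)).
rewrite (_ : (fun _ => _) = fun z => if z.2 then k (w, z.1) [set b | b != true]
                                    else k (w, z.1) [set b | b != false]).
  exact: measurable_fun_if_pair (m _) (m _).
by apply/funext => -[x []].
Qed.

(** [u z] is the probability of erring at [z], over both the seed and the kernel. The errors at the
    two labels of a point are complementary events, and integration over the seed commutes with a
    finite sum. *)
Lemma expected_error_mixture : exists u : X * bool -> R,
  [/\ forall z, (0 <= u z)%R,
      forall x, (u (x, true) + u (x, false) = 1)%R &
      forall s (s1 : (\sum_(q <- s) q.1%:num = 1)%R),
        expected_error (mixture s1) h = (\sum_(q <- s) q.1%:num * u q.2)%R%:E].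
Proof.
pose U (z : X * bool) := \int[rh_law h]_w k (w, z.1) [set b | b != z.2].
have mk x B : measurable_fun [set: rh_seed h] (fun w => k (w, x) B).
  exact: (measurable_fun_pair1 (f := fun z => k z B) x (measurable_kernel k B _)).
have U0 z : 0 <= U z by apply: integral_ge0.
have U1 x : U (x, true) + U (x, false) = 1.
  rewrite -ge0_integralD//=.
  rewrite (eq_integral (cst 1)) => [|w _].
    by rewrite integral_cst//= probability_setT mule1.
  rewrite -measureU//; last by apply/seteqP; split => -[] // [].
  rewrite (_ : _ `|` _ = setT); first exact: prob_kernel.
  by apply/seteqP; split => -[] // _; [right|left].
have Ufin z : U z \is a fin_num.
  have : U (z.1, true) + U (z.1, false) \is a fin_num by rewrite U1.
  by rewrite fin_numD => /andP[]; case: z => x [].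
exists (fun z => fine (U z)); split => [z|x|s s1].
- exact: fine_ge0.
- by apply: EFin_inj; rewrite EFinD !fineK.
pose f (q : {nonneg R} * (X * bool)) w :=
  q.1%:num%:E * k (w, q.2.1) [set b | b != q.2.2].
rewrite /expected_error (eq_integral (fun w => \sum_(q <- s) f q w)) => [|w _].
  rewrite -sumEFin (@ge0_integral_sum _ _ _ _ _ _ _ f)//.
  - by apply: eq_bigr => q _; rewrite EFinM fineK// ge0_integralZl.
  - by move=> q; exact: measurable_funeM.
  - by move=> q w _; rewrite mule_ge0.
by rewrite ge0_integral_mixture//; exact: measurable_rh_error.
Qed.

End expected_error.

(** Shattering is applied to the set of points where [g] is true; injectivity of the enumeration
    recovers [g] from that set. *)
Lemma shattered_sequence (X : pointedType) (C : set (X -> bool)) d :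
  has_VCdim C d -> exists x : nat -> X, forall g : nat -> bool,
    exists2 c, C c & forall i, (i < d)%N -> c (x i) = g i.
Proof.
move=> [[S Sd CS] _].
have /card_set_bijP[x [xS xinj xsurj]] : (`I_d #= S)%card by rewrite card_eq_sym.
exists x => g; have [|c Cc cB] := CS (x @` [set i | (i < d)%N /\ g i]).
  by move=> _ [i [/xS]] ? _ <-.
exists c => // i id; apply/idP/idP => [cxi|gi].
  have : (S `&` [set y | c y = true]) (x i) by split; [exact: xS|].
  rewrite cB => -[k [kd gk]] /xinj <- //; exact/mem_set.
have : (x @` [set i | (i < d)%N /\ g i]) (x i) by exists i.
by rewrite -cB => -[].
Qed.

Section labeled_mixture.
Context (R : realType) (d : measure_display) (X : measurableType d).
Variables (s : seq ({nonneg R} * X)) (c : X -> bool).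

Definition label := [seq (q.1, (q.2, c q.2)) | q <- s].

Hypothesis s1 : (\sum_(q <- s) q.1%:num = 1)%R.

Lemma sum_label : (\sum_(q <- label) q.1%:num = 1)%R.
Proof. by rewrite big_map. Qed.

Lemma is_labeled_law_mixture :
  is_labeled_law (mixture s1) c (mixture sum_label).
Proof. by move=> E _; rewrite /pushforward/= !mixtureE big_map. Qed.

End labeled_mixture.

(** * The clean and corrupted distributions: distance and mean error *)

Section hard_pair.
Context (R : realType) (d : measure_display) (X : measurableType d).
Variables (N : nat) (x : nat -> X) (e f r : {nonneg R}).
Hypothesis eE : (e%:num = N%:R * f%:num)%R.
Hypothesis er1 : (3 * e%:num + r%:num = 1)%R.

Definition clean_marginal j : seq ({nonneg R} * X) :=
  [:: (e, x 0), (e, x j.+2), (r, x 1) & [seq (f, x i.+2) | i <- index_iota 0 N]].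

Definition corrupted : seq ({nonneg R} * (X * bool)) :=
  [:: (e, (x 0, true)), (e, (x 0, false)), (r, (x 1, true)) &
      [seq (f, (x i.+2, true)) | i <- index_iota 0 N]].

(* The seed j + b N, with j < N, encodes the index j and the bit b. *)
Definition seeds (w : {nonneg R}) : seq ({nonneg R} * nat) :=
  [seq (w, j) | j <- index_iota 0 N] ++ [seq (w, (j + N)%N) | j <- index_iota 0 N].

Lemma sum_clean_marginal j : (\sum_(q <- clean_marginal j) q.1%:num = 1)%R.
Proof.
rewrite !big_cons big_map/= sumr_const_nat subn0 -mulr_natl -eE -er1.
by ring.
Qed.

Lemma sum_corrupted : (\sum_(q <- corrupted) q.1%:num = 1)%R.
Proof.
rewrite !big_cons big_map/= sumr_const_nat subn0 -mulr_natl -eE -er1.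
by ring.
Qed.

Lemma sum_seeds (w : {nonneg R}) : (w%:num * (2 * N%:R) = 1)%R ->
  (\sum_(q <- seeds w) q.1%:num = 1)%R.
Proof.
move=> <-; rewrite big_cat !big_map/= sumr_const_nat subn0 -mulr_natl.
by ring.
Qed.

Local Notation S u := (\sum_(0 <= i < N) u (x i.+2, true))%R.

(** Serves twice: with [u] an indicator it gives the measure of a set, with [u] the error
    probabilities it gives the error. *)
Lemma sum_clean (c : X -> bool) b j (u : X * bool -> R) :
  (j < N)%N -> c (x 0) = b -> c (x 1) = true ->
  (forall i, (i < N)%N -> c (x i.+2) = (i != j)) ->
  (\sum_(q <- label (clean_marginal j) c) q.1%:num * u q.2 =
   e%:num * u (x 0, b) + e%:num * u (x j.+2, false) + r%:num * u (x 1%N, true) +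
   f%:num * (S u - u (x j.+2, true) + u (x j.+2, false)))%R.
Proof.
move=> jN c0 c1 cx; rewrite big_map !big_cons big_map/= c0 c1 cx// eqxx/=.
rewrite -!addrA; do 3 congr (_ + _)%R.
have jin : j \in index_iota 0 N by rewrite mem_index_iota.
rewrite -mulr_sumr (bigD1_seq j)//= ?iota_uniq// cx// eqxx/=.
rewrite [in RHS](bigD1_seq j)//= ?iota_uniq//.
rewrite [X in (_ + X)%R](_ : _ = \sum_(0 <= i < N | i != j) u (x i.+2, true))%R.
  by ring.
rewrite big_seq_cond [RHS]big_seq_cond; apply: eq_bigr => i /andP[].
by rewrite mem_index_iota => /= iN ij; rewrite cx// ij.
Qed.

Lemma sum_corruptedE (u : X * bool -> R) :
  (\sum_(q <- corrupted) q.1%:num * u q.2 =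
   e%:num * u (x 0, true) + e%:num * u (x 0, false) + r%:num * u (x 1%N, true) +
   f%:num * S u)%R.
Proof. by rewrite !big_cons big_map/= -mulr_sumr !addrA. Qed.

(** The terms in [r] and in the sum [S] cancel. What remains is [e + f] at [(x j.+2, false)], [- f]
    at [(x j.+2, true)] and [- e] at [(x 0, ~~ b)]. *)
Lemma dTV_clean_corrupted (c : X -> bool) b j : 
  (j < N)%N -> c (x 0) = b -> c (x 1) = true ->
  (forall i, (i < N)%N -> c (x i.+2) = (i != j)) ->
  dTV (mixture (sum_label c (sum_clean_marginal j))) (mixture sum_corrupted)
    <= (e%:num + f%:num)%:E.
Proof.
move=> jN c0 c1 cx; apply: ge_ereal_sup => _ [E _ <-] /=.
pose v z : R := (z \in E)%:R.
rewrite !mixtureE (sum_clean v jN c0 c1 cx) (sum_corruptedE v).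
rewrite -EFinB abse_EFin lee_fin ler_norml.
have bound (p : {nonneg R}) z : (0 <= p%:num * v z <= p%:num)%R.
  by rewrite /v; case: (_ \in E); rewrite ?mulr1 ?mulr0 lexx ?andbT ge0.
have := (bound e (x 0, true), bound e (x 0, false), bound e (x j.+2, false)).
have := (bound f (x j.+2, true), bound f (x j.+2, false)).
case: b {c0} => -[] /andP[? ?] /andP[? ?] [] [] /andP[? ?] /andP[? ?] /andP[? ?].
  by apply/andP; split; lra.
by apply/andP; split; lra.
Qed.

(** Seeds [j] and [j + N] share the index and differ in the bit, so their errors at [x 0] add up to
    exactly [e]. *)
Lemma mean_clean_error (w : {nonneg R}) (c : nat -> X -> bool)
    (u : X * bool -> R) :
  (w%:num * (2 * N%:R) = 1)%R ->
  (forall t, c t (x 0) = (N <= t)%N) -> (forall t, c t (x 1) = true) ->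
  (forall t i, (i < N)%N -> c t (x i.+2) = (i != t %% N)%N) ->
  (forall z, 0 <= u z)%R -> (forall y, u (y, true) + u (y, false) = 1)%R ->
  (3 / 2 * e%:num - f%:num <=
   \sum_(t <- seeds w) t.1%:num *
     \sum_(q <- label (clean_marginal (t.2 %% N)) (c t.2)) q.1%:num * u q.2)%R.
Proof.
move=> w1 c0 c1 cx u0 u1; rewrite big_cat !big_map/= -big_split/=.
have f0 : (0 <= f%:num)%R by [].
have r0 : (0 <= r%:num)%R by [].
(* A lower bound for the errors of seeds [j] and [j + N] together, dropping those at [x 1] and the
   mass [f] of [(x j.+2, false)]. *)
pose a j := (e%:num + 2 * (e%:num * (1 - u (x j.+2, true))) +
             2 * (f%:num * (S u - u (x j.+2, true))))%R.
apply: (@le_trans _ _ (\sum_(0 <= j < N) w%:num * a j)%R).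
  have SN : (S u <= N%:R)%R.
    rewrite -[N in N%:R]subn0 -[leRHS]sumr_const_nat; apply: ler_sum => i _.
    by rewrite -(u1 (x i.+2)) lerDl.
  have -> : (\sum_(0 <= j < N) w%:num * a j =
      w%:num * (N%:R * (e%:num + 2 * e%:num + 2 * (f%:num * S u)) -
                2 * (e%:num + f%:num) * S u))%R.
    rewrite -mulr_sumr; congr (_ * _)%R.
    have cstE (y : R) : (N%:R * y = \sum_(0 <= j < N) y)%R.
      by rewrite sumr_const_nat subn0 mulr_natl.
    rewrite cstE [X in _ = (_ - X)%R]mulr_sumr -sumrB.
    by apply: eq_bigr => j _; rewrite /a; ring.
  (* Since [e = N f], the terms [2 N f S] and [2 e S] cancel: only [2 f S] depends on the
     predictions. *)
  have -> : (N%:R * (e%:num + 2 * e%:num + 2 * (f%:num * S u)) -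
                2 * (e%:num + f%:num) * S u =
      N%:R * 3 * e%:num - 2 * f%:num * S u)%R by rewrite eE; ring.
  rewrite -[leLHS]mul1r -[X in (X * _)%R]w1 -[leLHS]mulrA.
  apply: ler_wpM2l => //.
  have := ler_wpM2l f0 SN.
  by rewrite eE; lra.
rewrite big_seq_cond [leRHS]big_seq_cond; apply: ler_sum => j.
rewrite mem_index_iota andbT => /= jN.
have jNN : ((j + N) %% N = j)%N by rewrite modnDr modn_small.
rewrite jNN modn_small//.
have cN i : (i < N)%N -> c j (x i.+2) = (i != j).
  by move=> iN; rewrite cx// modn_small.
have cNN i : (i < N)%N -> c (j + N)%N (x i.+2) = (i != j).
  by move=> iN; rewrite cx// jNN.
rewrite (sum_clean u jN (c0 j) (c1 j) cN).
rewrite (sum_clean u jN (c0 _) (c1 _) cNN).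
rewrite leqNgt jN leq_addl/= -mulrDr ler_wpM2l//.
have := (mulr_ge0 r0 (u0 (x 1%N, true)), mulr_ge0 f0 (u0 (x j.+2, false))).
rewrite /a.
have -> : (u (x 0%N, true) = 1 - u (x 0%N, false))%R by rewrite -(u1 (x 0%N)) addrK.
have -> : (u (x j.+2, true) = 1 - u (x j.+2, false))%R.
  by rewrite -(u1 (x j.+2)) addrK.
by move=> [? ?]; lra.
Qed.

End hard_pair.

(* The random pair (Dc, Dcorr) is given by random elements of the (measurable)
   space of probability measures, on a probability space (T, P).  The integral
   over t is the lower integral if the algorithm A makes the integrand
   non-measurable. *)
Theorem theorem7p3 (R : realType) :
  exists K : R,
  forall (dX : measure_display) (X : measurableType dX)
    (eta : R) (C : set (X -> bool)) (d : nat),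
    (0 <= eta <= 1)%R ->
    (forall c, C c -> measurable_fun [set: X] c) ->
    has_VCdim C d ->
    (4 <= d)%N ->
  exists (dT : measure_display) (T : measurableType dT) (P : probability T R)
    (Dc Dcorr : T -> probability (X * bool)%type R),
    [/\ measurable_fun [set: T] (Dc : T -> pprobability (X * bool)%type R),
        measurable_fun [set: T] (Dcorr : T -> pprobability (X * bool)%type R),
        {ae P, forall t,
           (exists2 c, C c &
              exists D : probability X R, is_labeled_law D c (Dc t)) /\
           dTV (Dc t) (Dcorr t) <= eta%:E} &
        forall A : algorithm R X,
          (Num.min (1 / 2) (3 * eta / 2) - K / d%:R)%:E
            <= \int[P]_t expected_error (Dc t) (A (Dcorr t))].
Proof.
exists 2%R => dX X eta C d /andP[eta0 eta1] _ Cd d4.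
have [x xP] := shattered_sequence Cd.
case: d d4 {Cd} xP => [|[|[|N']]]// d4 xP; pose N := N'.+1.
have N0 : (0 < N)%N by [].
pose m : R := (Num.min (1 / 3) eta)%R.
have m0 : (0 <= m)%R by rewrite le_min eta0 andbT; lra.
have m3 : (m <= 1 / 3)%R by rewrite ge_min lexx.
have N'0 : (0 < N%:R + 1 :> R)%R by rewrite ltr_wpDl.
(* The solution of [e = N f] and [e + f = m]; the cap [m <= 1 / 3] keeps [r = 1 - 3 e]
   nonnegative. *)
have f0 : (0 <= m / (N%:R + 1))%R by rewrite divr_ge0// ltW.
pose f : {nonneg R} := NngNum f0.
have e0 : (0 <= N%:R * f%:num)%R by rewrite mulr_ge0.
pose e : {nonneg R} := NngNum e0.
have eE : (e%:num = N%:R * f%:num)%R by [].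
have efm : (e%:num + f%:num = m)%R.
  by rewrite /e/= /f/=; field; rewrite gt_eqF.
have r0 : (0 <= 1 - 3 * e%:num)%R.
  have ? : (0 <= f%:num)%R by [].
  lra.
pose r : {nonneg R} := NngNum r0.
have er1 : (3 * e%:num + r%:num = 1)%R by rewrite /r/= addrC subrK.
have w0 : (0 <= (2 * N%:R)^-1 :> R)%R by rewrite invr_ge0 mulr_ge0.
pose w : {nonneg R} := NngNum w0.
have w1 : (w%:num * (2 * N%:R) = 1)%R by rewrite mulVf// mulf_neq0// pnatr_eq0.
have /choice[c cP] (t : nat) :
    exists c, [/\ C c, c (x 0%N) = (N <= t)%N, c (x 1%N) = true &
    forall i, (i < N)%N -> c (x i.+2) = (i != t %% N)%N].
  have [c Cc cE] := xP (fun k => match k with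
    | 0%N => (N <= t)%N | 1%N => true | i.+2 => (i != t %% N)%N end).
  by exists c; split => //; [rewrite cE|rewrite cE|move=> i iN; rewrite cE].
pose s1 t := sum_clean_marginal x eE er1 (t %% N).
(* All sets of seeds in [nat] are measurable, hence so is every family indexed by [t]. *)
exists _, nat, (mixture (sum_seeds w1)),
  (fun t => mixture (sum_label (c t) (s1 t))),
  (fun=> mixture (sum_corrupted x eE er1)).
split => //.
- apply: aeW => t; have [Cc c0 c1 cx] := cP t; split.
    exists (c t) => //; exists (mixture (s1 t)); exact: is_labeled_law_mixture.
  have := @dTV_clean_corrupted _ _ _ _ _ _ _ _ eE er1 (c t) _ _ (ltn_pmod t N0) c0 c1 cx.
  by move=> /le_trans; apply; rewrite efm lee_fin ge_min lexx orbT.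
(* The corrupted distribution is constant in [t], so one hypothesis, and one [u], faces all
   seeds. *)
move=> A; have [u [u0 u1 uE]] := expected_error_mixture (A (mixture
  (sum_corrupted x eE er1))).
under eq_integral do rewrite uE.
rewrite ge0_integral_mixture//; last first.
  move=> t; rewrite lee_fin; apply: sumr_ge0 => q _.
  by rewrite mulr_ge0.
under [leRHS]eq_bigr do rewrite -EFinM.
rewrite sumEFin lee_fin.
have [c0 c1 cx] : [/\ forall t, c t (x 0%N) = (N <= t)%N,
    forall t, c t (x 1%N) = true &
    forall t i, (i < N)%N -> c t (x i.+2) = (i != t %% N)%N].
  by split => [t|t|t i]; have [_ c0 c1 cx] := cP t; [..|exact: cx].
have := @mean_clean_error _ _ _ _ x e f r eE w c u w1 c0 c1 cx u0 u1.
apply: le_trans.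
have -> : (Num.min (1 / 2) (3 * eta / 2) = 3 / 2 * m :> R)%R.
  rewrite /m; case: (leP (1 / 3)%R eta) => ?; case: leP => ?; lra.
have efN : (e%:num = N%:R * f%:num)%R by [].
have f0' : (0 <= f%:num)%R by [].
(* As [e = m - f], the loss [3 e / 2 - f] equals [3 m / 2 - 5 f / 2]. With [d = N + 2],
   [5 f d / 2 <= 5 (e + f) = 5 m <= 5 / 3], which is below the constant 2. *)
suff : (5 / 2 * f%:num <= 2 / N'.+3%:R)%R.
  move: efm; move: (e%:num)%R (f%:num)%R (2 / N'.+3%:R)%R (m) => a b y z; lra.
rewrite ler_pdivlMr ?ltr0n//.
have -> : (N'.+3%:R = N%:R + 2 :> R)%R by rewrite -(natrD _ N 2) addn2.
lra.
Qed.
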